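(* Let $\alpha\in\mathbb{T}$ not be a root of unity. For every strictly increasing sequence $(n_k)_{k\ge1}$ of positive integers, there is a dense $G_\delta$ set $\mathcal{B}$ in the space of mean-zero functions in $C(\mathbb{T})$ (with the uniform norm) such that for any $f\in\mathcal{B}$, the series $\sum_{k=1}^\infty M_{n_k}^\alpha f$ is not absolutely convergent, i.e. $\sum_{k=1}^\infty\|M_{n_k}^\alpha f\|_\infty=\infty$.
   Context: $\mathbb{T}=\{z\in\mathbb{C}:|z|=1\}$, and $C(\mathbb{T})$ is the space of continuous functions on $\mathbb{T}$ with the uniform norm $\|\cdot\|_\infty$. A function $f$ is mean-zero if its integral over $\mathbb{T}$ with respect to normalized Lebesgue measure is $0$. For $f\in C(\mathbb{T})$, $M_n^\alpha f(\gamma)=\frac1n\sum_{j=1}^nf(\alpha^j\gamma)$. *)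

(* Defs.v *)
From HB Require Import structures.
From mathcomp Require Import all_boot all_order all_algebra.
From mathcomp Require Import all_classical all_reals all_analysis.
From mathcomp Require Import borel_hierarchy complex.

Set Implicit Arguments.
Unset Strict Implicit.
Unset Printing Implicit Defensive.

Import Order.TTheory GRing.Theory Num.Theory.
Import numFieldNormedType.Exports.
(* makes the topology of [continuousType U V] that of uniform convergence; see
   [nbhs_continuousTypeP] *)
Export ArrowAsUniformType.

Local Open Scope classical_set_scope.
Local Open Scope ring_scope.
Local Open Scope complex_scope.

HB.instance Definition _ (R : rcfType) := PseudoPointedMetric.copy R[i] R[i]^o.
HB.instance Definition _ (R : rcfType) := NormedModule.copy R[i] R[i]^o.

Definition unit_circle (R : realType) : set R[i] := [set z | `|z| = 1].
Notation circle R := (set_type (@unit_circle R)).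

Section circle.
Context {R : realType}.
Implicit Types (a z : circle R) (t : R) (f : circle R -> R[i]).

Lemma rotation_subproof a (j : nat) z :
  set_val a ^+ j * set_val z \in @unit_circle R.
Proof.
have /= a1 := set_mem (valP a); have /= z1 := set_mem (valP z).
by apply/mem_set; rewrite /unit_circle /= normrM normrX a1 z1 expr1n mulr1.
Qed.

Definition rotation a (j : nat) z : circle R := SigSub (rotation_subproof a j z).

Lemma expi_subproof t :
  (cos (2 * pi * t) +i* sin (2 * pi * t))%C \in @unit_circle R.
Proof.
by apply/mem_set; rewrite /unit_circle /= normc_def /= cos2Dsin2 sqrtr1.
Qed.

(* t |-> exp(2 i pi t) *)
Definition expi t : circle R := SigSub (expi_subproof t).

(* Normalized Lebesgue measure on the circle is the image under [expi] of
   Lebesgue measure on [0, 1]. *)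
Definition circle_integral f : R[i] :=
  (\int[lebesgue_measure]_(t in `[0, 1]) complex.Re (f (expi t)))%R +i*
  (\int[lebesgue_measure]_(t in `[0, 1]) complex.Im (f (expi t)))%R.

Definition supnorm f : R := sup [set Normc.normc (f z) | z in setT].

Definition ergodic_mean a (n : nat) f z : R[i] :=
  n%:R^-1 * \sum_(1 <= j < n.+1) f (rotation a j z).

End circle.

Definition mean_zero (R : realType) : set (continuousType (circle R) R[i]) :=
  [set f | circle_integral f = 0].

Lemma nbhs_continuousTypeP (R : realType)
    (f : continuousType (circle R) R[i])
    (A : set (continuousType (circle R) R[i])) :
  nbhs f A <->
  exists2 e : R, 0 < e &
    [set g : continuousType (circle R) R[i] |
      forall z, Normc.normc (f z - g z) < e] `<=` A.
Proof.
split.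
- case=> _ [[B oB <-] /= Bf BA].
  have : nbhs (f : arrow_uniform_type (circle R) R[i]) B.
    exact: open_nbhs_nbhs.
  rewrite -nbhs_entourageE => -[E' [E + EE'] E'B].
  rewrite -entourage_ballE => -[/= e]; rewrite ltcE /= => /andP[/eqP Ime e0] eE.
  exists (complex.Re e) => // g fg; apply/BA/E'B/xsectionP/EE' => z /=.
  by apply: eE; rewrite /ball /= ltcE /= Ime eqxx fg.
- move=> [e e0 eA]; rewrite -nbhs_entourageE.
  pose E := [set w : R[i] * R[i] | ball w.1 e%:C w.2].
  pose E' := [set fg : (circle R -> R[i]) * (circle R -> R[i]) |
    forall z, E (fg.1 z, fg.2 z)].
  exists [set fg | E' (Continuous.sort fg.1, Continuous.sort fg.2)]; last first.
    move=> g /xsectionP/= fg; apply: eA => z.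
    by move: (fg z); rewrite /E /ball /= ltcE /= eqxx.
  exists E' => //; exists E => //; rewrite -entourage_ballE.
  by exists e%:C => //=; rewrite ltcE /= eqxx.
Qed.

(* Main.v *)
Require Import Defs.
From mathcomp Require Import all_boot all_order all_algebra.
From mathcomp Require Import all_classical all_reals all_analysis.
From mathcomp Require Import borel_hierarchy complex.
From mathcomp Require Import ring lra.

Set Implicit Arguments.
Unset Strict Implicit.
Unset Printing Implicit Defensive.

Import Order.TTheory GRing.Theory Num.Theory.
Import numFieldNormedType.Exports.

Local Open Scope classical_set_scope.
Local Open Scope ring_scope.

(** Write S f for the sum over k of the uniform norms of the means of f along
    the lengths n k, and let B be the set of mean-zero f with S f infinite.

    B is a G_delta because each partial sum of S is continuous for the uniform
    norm, so that B is the intersection over N of the open sets where some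
    partial sum exceeds N.  Density needs no category argument, only one point
    of B: if g is in B and S f is finite, then f + t g is in B for every t > 0
    by the triangle inequality, and it is as close to f as desired
    ([divergent_mean_dense]).

    It remains to find one mean-zero function with infinite S
    ([divergent_mean_exists]).  Let a be the rotation.  As a is not a root of
    unity, some power w = a ^ m is as close to 1 as desired without being 1
    ([small_power]).  The function
      probe a m z = (|z ^ m - 1| - |z ^ m - w|) / |w - 1|
    is bounded by 1, and it is a coboundary: |z ^ m - w| is the value of
    |z ^ m - 1| at z / a.  Its sums along orbits therefore telescope, and the
    sum of length n from the point 1 exceeds the one from a ^ -n by at least
    |w ^ n - 1| / |w - 1|.  This is never negative, and at least n / 2 as long
    as n |w - 1| <= 1 / 2.  So in a series F of such probes with weights
    2 ^ -(i + 1) nothing cancels between the two starting points, and the i-th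
    term alone makes the mean of F of length n oscillate by at least
    2 ^ -i / 4.  Choosing m i so that this holds for the first 8 * 4 ^ i
    lengths n k, their contribution to S is at least 2 ^ i.  Only oscillations
    were used, so subtracting from F its integral, which gives a mean-zero
    function, does not affect the estimate. *)

(** * The real-valued complex modulus *)

Section modulus.
Context {R : realType}.
Implicit Types (x y z : R[i]) (t : R).
Local Notation nc := (@Normc.normc R).

Lemma norm_normc x : `|x| = (nc x)%:C%C.
Proof. by case: x. Qed.

Lemma normc_ge0 x : 0 <= nc x.
Proof. by case: x => a b; exact: sqrtr_ge0. Qed.

(** [normcN] and [le_normcD] are stated for the module [Rcomplex R]; here they
    are transferred to the ring [R[i]]. *)
Lemma normc_oppr x : nc (- x) = nc x.
Proof. exact: normcN. Qed.

Lemma normcB_sym x y : nc (x - y) = nc (y - x).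
Proof. by apply: complexI; rewrite -!norm_normc distrC. Qed.

Lemma normc_triangle x y : nc (x + y) <= nc x + nc y.
Proof. exact: le_normcD. Qed.

Lemma normc_sum (I : Type) (r : seq I) (F : I -> R[i]) :
  nc (\sum_(i <- r) F i) <= \sum_(i <- r) nc (F i).
Proof.
elim/big_ind2 : _ => //; first by rewrite Normc.normc0.
by move=> a b c d ab cd; exact: le_trans (normc_triangle _ _) (lerD _ _).
Qed.

Lemma dist_normc_le x y : `|nc x - nc y| <= nc (x - y).
Proof.
have := normc_triangle (x - y) y; have := normc_triangle (y - x) x.
rewrite !subrK (normcB_sym y x) => yx xy.
by rewrite ler_norml; apply/andP; split; lra.
Qed.

Lemma normcX x n : nc (x ^+ n) = nc x ^+ n.
Proof. by apply: complexI; rewrite rmorphXn /= -!norm_normc normrX. Qed.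

Lemma normc_real t : nc t%:C%C = `|t|.
Proof. by rewrite /= expr0n addr0 sqrtr_sqr. Qed.

Lemma normc_nat n : nc n%:R = n%:R.
Proof. by apply: complexI; rewrite rmorph_nat -norm_normc normr_nat. Qed.

Lemma normr_Re_le x : `|complex.Re x| <= nc x.
Proof. by move: (normc_ge_Re x); rewrite norm_normc lecR. Qed.

Lemma normr_Im_le x : `|complex.Im x| <= nc x.
Proof.
case: x => a b /=; rewrite -[`|b|]sqrtr_sqr ler_sqrt ?addr_ge0 ?sqr_ge0//.
by rewrite lerDr sqr_ge0.
Qed.

Lemma normc_le_ReIm x : nc x <= `|complex.Re x| + `|complex.Im x|.
Proof.
case: x => a b; have h : 0 <= `|a| + `|b| by rewrite addr_ge0.
rewrite /= -[leRHS](ger0_norm h) -sqrtr_sqr ler_sqrt ?sqr_ge0//.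
rewrite sqrrD !real_normK ?num_real//.
by rewrite addrAC lerDl mulrn_wge0// mulr_ge0.
Qed.

(** The topology of [R[i]] is given by balls whose radius is itself a complex
    number; this trades them for real radii. *)
Lemma continuous_complexP (T : topologicalType) (f : T -> R[i]) (a : T) :
  {for a, continuous f} <->
  forall e : R, 0 < e -> \forall b \near a, nc (f a - f b) < e.
Proof.
rewrite /continuous_at; split.
  move=> /cvgrPdist_lt fa e e0.
  have e0' : 0 < e%:C%C :> R[i] by rewrite ltcR.
  by apply: filterS (fa _ e0') => b; rewrite norm_normc ltcR.
move=> fa; apply/cvgrPdist_lt => e; rewrite ltcE /= => /andP[/eqP Ime e0].
by apply: filterS (fa _ e0) => b; rewrite norm_normc ltcE /= Ime eqxx.
Qed.

Lemma continuous_lipschitz_complex (T : topologicalType) (f : T -> R[i])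
    (p : R[i] -> R) : (forall x y, `|p x - p y| <= nc (x - y)) ->
  continuous f -> continuous (fun a => p (f a)).
Proof.
move=> p_lip cf a; apply/cvgrPdist_lt => e e0.
have /continuous_complexP/(_ e e0) := cf a.
by apply: filterS => b; apply: le_lt_trans; exact: p_lip.
Qed.

Lemma continuous_Re (T : topologicalType) (f : T -> R[i]) :
  continuous f -> continuous (fun a => complex.Re (f a)).
Proof.
by apply: continuous_lipschitz_complex => x y; rewrite -raddfB normr_Re_le.
Qed.

Lemma continuous_Im (T : topologicalType) (f : T -> R[i]) :
  continuous f -> continuous (fun a => complex.Im (f a)).
Proof.
by apply: continuous_lipschitz_complex => x y; rewrite -raddfB normr_Im_le.
Qed.

Lemma continuous_normc (T : topologicalType) (f : T -> R[i]) :
  continuous f -> continuous (fun a => nc (f a)).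
Proof. by apply: continuous_lipschitz_complex; exact: (@dist_normc_le). Qed.

Lemma continuous_real_complex (T : topologicalType) (F : T -> R) :
  continuous F -> continuous (fun a => (F a)%:C%C).
Proof.
move=> cF a; apply/continuous_complexP => e e0.
have /cvgrPdist_lt/(_ e e0) := cF a; apply: filterS => b.
by rewrite -rmorphB normc_real.
Qed.

Lemma continuous_lincomb (T : topologicalType) (f g : T -> R[i]) (c : R[i]) :
  continuous f -> continuous g -> continuous (fun a => f a + c * g a).
Proof.
move=> cf cg a; apply: cvgD; first exact: cf.
by apply: cvgM; [exact: cvg_cst|exact: cg].
Qed.

Lemma continuous_scale (T : topologicalType) (F : T -> R) (c : R) :
  continuous F -> continuous (fun a => c * F a).
Proof. by move=> cF a; apply: cvgM; [exact: cvg_cst|exact: cF]. Qed.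

Lemma continuous_sub (T : topologicalType) (F G : T -> R) :
  continuous F -> continuous G -> continuous (fun a => F a - G a).
Proof. by move=> cF cG a; apply: cvgB; [exact: cF|exact: cG]. Qed.

End modulus.

(** * The circle and its parametrization *)

Section circle.
Context {R : realType}.
Local Notation nc := (@Normc.normc R).
Local Notation T := (circle R).
Implicit Types (z : T) (f g : T -> R[i]).

Lemma normc_circle z : nc (set_val z) = 1.
Proof.
by have := set_mem (valP z) => /= h; apply: complexI; rewrite -norm_normc.
Qed.

Lemma circle_neq0 z : set_val z != 0.
Proof.
apply/eqP => z0; move: (normc_circle z); rewrite z0 Normc.normc0 => /eqP.
by rewrite eq_sym oner_eq0.
Qed.

Lemma circle_exists (x : R[i]) : nc x = 1 -> exists z, set_val z = x.
Proof.
move=> x1; have h : x \in @unit_circle R.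
  by apply/mem_set => /=; rewrite /unit_circle /= norm_normc x1.
by exists (SigSub h).
Qed.

Lemma expi_surj z : exists2 t : R, t \in `[0, 1] & expi t = z.
Proof.
have pi2 : 0 < 2 * pi :> R by rewrite mulr_gt0// pi_gt0.
have /= := normc_circle z; case E : (set_val z) => [a b] /= ab.
have {}ab : a ^+ 2 + b ^+ 2 = 1.
  by rewrite -[LHS]sqr_sqrtr ?addr_ge0 ?sqr_ge0// ab expr1n.
have a1 : -1 <= a <= 1.
  by rewrite -ler_norml -[_ <= _]ler_sqr ?nnegrE// real_normK ?num_real// expr1n; nra.
have sa : sin (acos a) = `|b|.
  by rewrite sin_acos// -sqrtr_sqr; congr Num.sqrt; rewrite -ab; ring.
have aI : a \in `[(-1)%R, 1] by rewrite in_itv.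
have a0 := acos_ge0 a1; have api := acos_lepi a1.
(* The arc cosine covers the upper half circle, and the reflected angle the
   lower one. *)
have [b0|b0] := leP 0 b.
  exists (acos a / (2 * pi)).
    rewrite in_itv/= divr_ge0 ?(ltW pi2)//= ler_pdivrMr// mul1r.
    by have := pi_gt0 R; lra.
  apply: val_inj; apply: etrans (esym E) => /=; rewrite mulrC divfK ?gt_eqF//.
  by rewrite acosK// sa ger0_norm.
exists (1 - acos a / (2 * pi)).
  rewrite in_itv/= subr_ge0 lerBlDr lerDl divr_ge0 ?(ltW pi2)// andbT.
  by rewrite ler_pdivrMr// mul1r; have := pi_gt0 R; lra.
apply: val_inj; apply: etrans (esym E) => /=; rewrite mulrBr mulr1.
rewrite [2 * pi * (_ / _)]mulrC divfK ?gt_eqF//.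
rewrite cosB sinB mulr_natl cos2pi sin2pi acosK// sa ltr0_norm//.
by congr (_ +i* _)%C; ring.
Qed.

Lemma continuous_expi : continuous (@expi R).
Proof.
have cts (f : R -> R) : continuous f -> continuous (fun t : R => f (2 * pi * t)).
  move=> cf t; apply: continuous_comp; last exact: cf.
  by apply: mulrl_continuous.
have cc := cts _ (@continuous_cos R); have cs := cts _ (@continuous_sin R).
have cv : continuous ((set_val : T -> R[i]) \o @expi R).
  move=> t; apply/continuous_complexP => e e0.
  have e2 : 0 < e / 2 by rewrite divr_gt0.
  near=> s.
  apply: le_lt_trans (normc_le_ReIm _) _ => /=.
  rewrite [ltRHS]splitr ltrD//; near: s.
    by move/cvgrPdist_lt : (cc t); apply.
  by move/cvgrPdist_lt : (cs t); apply.
by apply: continuous_comp_initial.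
Unshelve. all: by end_near. Qed.

(** The circle is the continuous image of the segment [0, 1], on which the
    modulus attains its maximum. *)
Lemma continuous_circle_bounded f : continuous f ->
  exists M : R, forall z, nc (f z) <= M.
Proof.
move=> cf.
have c : continuous (fun t : R => nc (f (expi t))).
  apply: (@continuous_normc _ _ (f \o @expi R)) => t.
  by apply: continuous_comp; [exact: continuous_expi|exact: cf].
have [t _ ft] := EVT_max ler01 (continuous_subspaceT c).
exists (nc (f (expi t))) => z; have [s s01 <-] := expi_surj z.
exact: ft.
Qed.

End circle.

(** * Uniform norms of ergodic means *)

Section supnorm.
Context {R : realType}.
Local Notation nc := (@Normc.normc R).
Local Notation T := (circle R).
Implicit Types (z : T) (f g : T -> R[i]).

(** The supremum of an unbounded set is 0 by convention, hence the explicit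
    bound M. *)
Lemma supnorm_ge f (M : R) z :
  (forall w, nc (f w) <= M) -> nc (f z) <= supnorm f.
Proof.
move=> fM; apply: ub_le_sup; last by exists z.
by exists M => _ [w _ <-]; exact: fM.
Qed.

Lemma supnorm_le f (M : R) : (forall z, nc (f z) <= M) -> supnorm f <= M.
Proof.
move=> fM; apply: ge_sup; first by exists (nc (f (expi 0))), (expi 0).
by move=> _ [w _ <-]; exact: fM.
Qed.

Lemma supnorm_ge0 f (M : R) : (forall z, nc (f z) <= M) -> 0 <= supnorm f.
Proof.
by move=> fM; apply: le_trans (supnorm_ge (expi 0) fM); exact: normc_ge0.
Qed.

Lemma ergodic_mean_le a n f (M : R) : (0 < n)%N ->
  (forall z, nc (f z) <= M) -> forall z, nc (ergodic_mean a n f z) <= M.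
Proof.
move=> n0 fM z; have n0' : 0 < n%:R :> R by rewrite ltr0n.
rewrite /ergodic_mean Normc.normcM Normc.normcV.
rewrite normc_nat mulrC ler_pdivrMr//.
apply: le_trans (normc_sum _ _) _.
apply: (@le_trans _ _ (\sum_(1 <= j < n.+1) M)); first exact: ler_sum.
by rewrite sumr_const_nat subn1 mulr_natr.
Qed.

Lemma ergodic_meanD a n f g (c : R[i]) z :
  ergodic_mean a n (fun w => f w + c * g w) z =
  ergodic_mean a n f z + c * ergodic_mean a n g z.
Proof.
by rewrite /ergodic_mean big_split/= -mulr_sumr mulrDr mulrCA.
Qed.

(** The triangle inequality in the form that makes divergence propagate: a large
    mean of g forces a large mean of f or of its perturbation f + t g. *)
Lemma supnorm_mean_perturb a n f g (t : R) :
  (0 < n)%N -> continuous f -> continuous g -> 0 < t ->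
  t * supnorm (ergodic_mean a n g) <=
  supnorm (ergodic_mean a n (fun w => f w + t%:C%C * g w)) +
  supnorm (ergodic_mean a n f).
Proof.
move=> n0 cf cg t0.
have [M fM] := continuous_circle_bounded cf.
have [N hN] := continuous_circle_bounded (continuous_lincomb (c := t%:C%C) cf cg).
rewrite mulrC -ler_pdivlMr//; apply: supnorm_le => z.
rewrite ler_pdivlMr// mulrC -[X in X * _](gtr0_norm t0) -normc_real -Normc.normcM.
rewrite -[t%:C%C * _](addKr (ergodic_mean a n f z)) -ergodic_meanD addrC.
apply: le_trans (normc_triangle _ _) _; rewrite normc_oppr; apply: lerD.
  exact: supnorm_ge (ergodic_mean_le _ n0 hN).
exact: supnorm_ge (ergodic_mean_le _ n0 fM).
Qed.

Lemma supnorm_mean_close a n f g (e : R) :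
  (0 < n)%N -> continuous f -> continuous g ->
  (forall z, nc (f z - g z) < e) ->
  supnorm (ergodic_mean a n f) <= supnorm (ergodic_mean a n g) + e.
Proof.
move=> n0 cf /continuous_circle_bounded[N gN] fg.
apply: supnorm_le => z.
have -> : ergodic_mean a n f z =
    ergodic_mean a n g z + ergodic_mean a n (fun w => f w - g w) z.
  rewrite /ergodic_mean -mulrDr -big_split/=; congr (_ * _).
  by apply: eq_bigr => i _; rewrite addrC subrK.
apply: le_trans (normc_triangle _ _) _; apply: lerD.
  exact: supnorm_ge (ergodic_mean_le _ _ gN).
by apply: (ergodic_mean_le _ _ _) => // w; exact: ltW.
Qed.

End supnorm.

(** * The integral over the circle *)

Section mean_zero.
Context {R : realType}.
Local Notation nc := (@Normc.normc R).
Local Notation T := (circle R).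
Local Notation mu := (@lebesgue_measure R).
Implicit Types (f g : T -> R[i]).

Lemma integrable_circle (F : T -> R) : continuous F ->
  mu.-integrable `[0, 1] (EFin \o (F \o @expi R)).
Proof.
move=> cF; apply: continuous_compact_integrable; first exact: segment_compact.
apply: continuous_subspaceT => t.
by apply: continuous_comp; [exact: continuous_expi|exact: cF].
Qed.

(** Both integrals are taken separately on the real and imaginary parts, hence
    the restriction to a real scalar. *)
Lemma circle_integralD f g (c : R) : continuous f -> continuous g ->
  circle_integral (fun z => f z + c%:C%C * g z) =
  circle_integral f + c%:C%C * circle_integral g.
Proof.
move=> cf cg.
have [rf jf] := (continuous_Re cf, continuous_Im cf).
have [rg jg] := (continuous_Re cg, continuous_Im cg).
have lin (u v : T -> R) : continuous u -> continuous v ->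
    \int[mu]_(t in `[0, 1]) (u (expi t) + c * v (expi t)) =
    \int[mu]_(t in `[0, 1]) u (expi t) + c * \int[mu]_(t in `[0, 1]) v (expi t).
  move=> cu cv; have ccv := continuous_scale (c := c) cv.
  rewrite (RintegralD _ (integrable_circle cu) (integrable_circle ccv))//.
  by rewrite (RintegralZl _ _ (integrable_circle cv)).
have -> : forall x y : R[i], x + c%:C%C * y =
    ((complex.Re x + c * complex.Re y) +i* (complex.Im x + c * complex.Im y))%C.
  by move=> [a b] [a' b']; simpc.
rewrite /circle_integral /= -(lin _ _ rf rg) -(lin _ _ jf jg); congr (_ +i* _)%C;
  apply: eq_Rintegral => t _; case: (f _) (g _) => [a b] [a' b'] /=.
  by rewrite mul0r subr0.
by rewrite mul0r addr0.
Qed.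

Lemma circle_integral_real (F : T -> R) :
  circle_integral (fun z => (F z)%:C%C) =
  (\int[mu]_(t in `[0, 1]) F (expi t))%:C%C.
Proof. by rewrite /circle_integral /= Rintegral_cst//= mul0r. Qed.

Lemma circle_integral_sub_mean (F : T -> R) : continuous F ->
  exists c : R, circle_integral (fun z => (F z - c)%:C%C) = 0.
Proof.
move=> cF; exists (\int[mu]_(t in `[0, 1]) F (expi t)).
rewrite circle_integral_real.
set c := (\int[mu]_(t in _) F _).
have cc : continuous (fun _ : T => c) by exact: cst_continuous.
rewrite (RintegralB _ (integrable_circle cF) (integrable_circle cc))//.
rewrite Rintegral_cst//= lebesgue_measure_itv/= lte01 oppr0 adde0/= mulr1.
by rewrite subrr.
Qed.

End mean_zero.

(** * Geometrically dominated series of continuous functions *)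

Section weierstrass.
Context {R : realType} {T : topologicalType}.

Lemma sum_half_pow (M N : nat) : (M <= N)%N ->
  \sum_(M <= i < N) 2^-1 ^+ i.+1 <= 2^-1 ^+ M :> R.
Proof.
move=> MN.
rewrite (@telescope_sumr_eq _ M N (fun i => - 2^-1 ^+ i))//.
  by rewrite opprK addrC gerBl exprn_ge0// invr_ge0.
by move=> k _; rewrite exprS; field.
Qed.

(** The Weierstrass test: the tail after M terms is at most 2 ^ -M uniformly, so
    that continuity passes from the partial sums to the sum. *)
Lemma continuous_series (u : nat -> T -> R) :
  (forall i, continuous (u i)) ->
  (forall i z, `|u i z| <= 2^-1 ^+ i.+1) ->
  exists2 F : T -> R, continuous F & forall z, series (u ^~ z) @ \oo --> F z.
Proof.
move=> cu uM.
have half1 : `|2^-1 : R| < 1 by rewrite ger0_norm// invf_lt1// ltr1n.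
have cS N : continuous (fun z => series (u ^~ z) N).
  elim: N => [|N IH].
    rewrite (_ : (fun _ => _) = cst 0); first by move=> ?; exact: cvg_cst.
    by apply/funext => z; rewrite /series/= big_nil.
  rewrite (_ : (fun _ => _) = (fun z => series (u ^~ z) N + u N z)).
    by move=> z; apply: cvgD; [exact: IH|exact: cu].
  by apply/funext => z; rewrite /series/= big_nat_recr.
have cvgS z : cvgn (series (u ^~ z)).
  apply: normed_cvg.
  apply: (@series_le_cvg _ _ (geometric 2^-1 2^-1)) => [i|i|i|].
  - exact: normr_ge0.
  - by apply: mulr_ge0 => //; exact: exprn_ge0.
  - by rewrite /geometric/= -exprS.
  - exact: is_cvg_geometric_series.
have tail z M : `|limn (series (u ^~ z)) - series (u ^~ z) M| <= 2^-1 ^+ M.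
  have : `|series (u ^~ z) N - series (u ^~ z) M| @[N --> \oo] -->
      `|limn (series (u ^~ z)) - series (u ^~ z) M|.
    by apply: cvg_norm; apply: cvgB; [exact: cvgS|exact: cvg_cst].
  move/cvgr_to_le; apply; exists M => // N /= MN.
  rewrite /series/= (big_cat_nat _ MN)//= addrAC subrr add0r.
  apply: le_trans (ler_norm_sum _ _ _) _.
  by apply: le_trans (sum_half_pow MN); apply: ler_sum.
exists (fun z => limn (series (u ^~ z))); last exact: cvgS.
move=> z; apply/cvgrPdist_lt => e e0.
have [M Me] : exists M, 2^-1 ^+ M < e / 3 :> R.
  have e3 : 0 < e / 3 by rewrite divr_gt0.
  have /cvgrPdist_lt/(_ _ e3)[M _ /(_ M (leqnn _))] := cvg_expr half1.
  by rewrite sub0r normrN ger0_norm ?exprn_ge0 ?invr_ge0//; exists M.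
have e3 : 0 < e / 3 by rewrite divr_gt0.
have /cvgrPdist_lt/(_ _ e3) := cS M z; apply: filterS => w zw.
have := tail z M; have := tail w M; rewrite distrC => tw tz.
rewrite (le_lt_trans (ler_distD (series (u ^~ z) M) _ _))//.
have := ler_distD (series (u ^~ w) M) (series (u ^~ z) M) (limn (series (u ^~ w))).
lra.
Qed.

End weierstrass.

(** * Powers of a complex number of modulus one *)

Section powers.
Context {R : realType}.
Local Notation nc := (@Normc.normc R).
Implicit Types (w : R[i]).

Lemma normc_expB1_le w n : nc w = 1 -> nc (w ^+ n - 1) <= n%:R * nc (w - 1).
Proof.
move=> w1; rewrite subrX1 Normc.normcM mulrC ler_wpM2r ?normc_ge0//.
apply: le_trans (normc_sum _ _) _.
under eq_bigr do rewrite normcX w1 expr1n.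
by rewrite sumr_const card_ord.
Qed.

(** In w ^ n - 1 = (w - 1) (1 + w + ... + w ^ (n - 1)) every power of w stays
    within n |w - 1| <= 1 / 2 of 1, so the geometric sum has modulus at least
    n / 2: the powers of w move away from 1 at linear speed. *)
Lemma normc_expB1_ge w n : nc w = 1 -> n%:R * nc (w - 1) <= 2^-1 ->
  n%:R / 2 * nc (w - 1) <= nc (w ^+ n - 1).
Proof.
move=> w1 nw; rewrite subrX1 Normc.normcM mulrC ler_wpM2l ?normc_ge0//.
have -> : \sum_(i < n) w ^+ i = n%:R + \sum_(i < n) (w ^+ i - 1).
  by rewrite sumrB sumr_const card_ord addrC subrK.
have le1 : nc (\sum_(i < n) (w ^+ i - 1)) <= n%:R / 2.
  apply: le_trans (normc_sum _ _) _.
  apply: (@le_trans _ _ (\sum_(i < n) 2^-1)); last first.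
    by rewrite sumr_const card_ord mulr_natl.
  apply: ler_sum => i _; apply: le_trans (normc_expB1_le _ w1) _.
  by apply: le_trans nw; rewrite ler_wpM2r ?normc_ge0// ler_nat ltnW.
have := normc_triangle (n%:R + \sum_(i < n) (w ^+ i - 1))
  (- \sum_(i < n) (w ^+ i - 1)).
rewrite addrK normc_nat normc_oppr; lra.
Qed.

(** Dirichlet's pigeonhole argument: among sufficiently many powers of w, two
    fall in the same cell of a fine square grid, and their quotient is a power
    of w close to 1. *)
Lemma small_power w (e : R) : nc w = 1 -> 0 < e ->
  exists2 m, (0 < m)%N & nc (w ^+ m - 1) < e.
Proof.
move=> w1 e0.
pose N := (Num.truncn (2 / e)).+1.
have N0 : 0 < N%:R :> R by rewrite ltr0n.
have Ne : 2 / N%:R < e.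
  by rewrite ltr_pdivrMr// mulrC -ltr_pdivrMr//; apply: truncnS_gt.
have w1X j : nc (w ^+ j) = 1 by rewrite normcX w1 expr1n.
(* The interval [-1, 1] is cut in pieces of length 1 / N; the endpoint 1 has a
   piece of its own, whence 2 N + 1 cells. *)
pose cell (x : R) : 'I_(N.*2).+1 := inord (Num.truncn ((x + 1) * N%:R)).
have cell_close x y : `|x| <= 1 -> `|y| <= 1 -> cell x = cell y ->
    `|x - y| < N%:R^-1.
  have cellE t : `|t| <= 1 -> (cell t)%:R <= (t + 1) * N%:R < (cell t).+1%:R.
    move=> t1; have t0 : 0 <= (t + 1) * N%:R.
      by rewrite mulr_ge0// -lerBlDr sub0r; move: t1; rewrite ler_norml => /andP[].
    rewrite /cell inordK ?truncn_itv//.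
    rewrite ltnS -(ler_nat R); apply: (@le_trans _ _ ((t + 1) * N%:R)).
      by rewrite truncn_le.
    rewrite -mul2n natrM ler_wpM2r// ?ler0n//.
    by move: t1; rewrite ler_norml => /andP[_]; lra.
  move=> /cellE/andP[xl xu] /cellE/andP[yl yu] xy.
  rewrite xy in xl xu; rewrite -[ltRHS]mul1r ltr_pdivlMr//.
  rewrite -{1}(ger0_norm (ltW N0)) -normrM mulrBl ltr_norml.
  by apply/andP; split; move: xl xu yl yu; rewrite -natr1 => *; lra.
pose K := ((N.*2).+1 * (N.*2).+1).+1.
pose f (j : 'I_K) := (cell (complex.Re (w ^+ j)), cell (complex.Im (w ^+ j))).
have : ~~ injectiveb f.
  apply/negP => /injectiveP/leq_card.
  by rewrite card_prod !card_ord ltnn.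
have step (i j : nat) : (i < j)%N ->
    nc (w ^+ i - w ^+ j) < e -> nc (w ^+ (j - i) - 1) < e.
  move=> ij; rewrite normcB_sym -{1}(subnK (ltnW ij)) exprD.
  by rewrite -{2}[w ^+ i]mul1r -mulrBl Normc.normcM w1X mulr1.
move=> /injectivePn[i [j ij [fR fI]]].
have close : nc (w ^+ i - w ^+ j) < e.
  apply: le_lt_trans (normc_le_ReIm _) _; rewrite !raddfB.
  apply: lt_trans Ne; rewrite mulr2n mulrDl !mul1r ltrD// cell_close//.
  - by rewrite -(w1X i) normr_Re_le.
  - by rewrite -(w1X j) normr_Re_le.
  - by rewrite -(w1X i) normr_Im_le.
  - by rewrite -(w1X j) normr_Im_le.
have [lt_ij|lt_ji|eq_ij] := ltngtP i j.
- by exists (j - i)%N; [rewrite subn_gt0|exact: step].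
- by exists (i - j)%N; [rewrite subn_gt0|apply: step; rewrite // normcB_sym].
- by move: ij; rewrite (ord_inj eq_ij) eqxx.
Qed.

End powers.

(** * A mean-zero function whose means are not summable *)

Section witness.
Context {R : realType}.
Local Notation nc := (@Normc.normc R).
Local Notation T := (circle R).
Implicit Types (a z : T).

(** The coboundary of |z ^ m - 1|, written with z ^ m - a ^ m in place of
    (z / a) ^ m - 1, which has the same modulus, and normalized by the Lipschitz
    bound |a ^ m - 1|. *)
Definition probe a (m : nat) z : R :=
  (nc (set_val z ^+ m - 1) - nc (set_val z ^+ m - set_val a ^+ m)) /
  nc (set_val a ^+ m - 1).

Lemma normr_probe_le1 a m z : `|probe a m z| <= 1.
Proof.
rewrite normrM normfV (ger0_norm (normc_ge0 _)).
have [->|a0] := eqVneq (nc (set_val a ^+ m - 1)) 0; first by rewrite invr0 mulr0.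
rewrite ler_pdivrMr ?lt_neqAle 1?eq_sym ?a0 ?normc_ge0// mul1r.
apply: le_trans (dist_normc_le _ _) _.
by rewrite opprB addrC addrA subrK lexx.
Qed.

Lemma continuous_set_val_exp m (c : R[i]) :
  continuous (fun z : T => set_val z ^+ m - c).
Proof.
move=> z; apply: (@continuous_comp _ _ _ (set_val : T -> R[i]) (fun x => x ^+ m - c)).
  exact: initial_continuous.
apply: continuousB; last exact: cst_continuous.
elim: m => [|m /(continuousM cvg_id) IH]; first exact: cst_continuous.
have -> : (fun x : R[i] => x ^+ m.+1) = id \* (fun x => x ^+ m).
  by apply/funext => x /=; rewrite exprS.
exact: IH.
Qed.

Lemma continuous_probe a m : continuous (probe a m).
Proof.
have c1 := continuous_normc (@continuous_set_val_exp m 1).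
have c2 := continuous_normc (@continuous_set_val_exp m (set_val a ^+ m)).
rewrite (_ : probe a m = fun z => (nc (set_val a ^+ m - 1))^-1 *
  (nc (set_val z ^+ m - 1) - nc (set_val z ^+ m - set_val a ^+ m))).
  exact/continuous_scale/continuous_sub.
by apply/funext => z; rewrite mulrC.
Qed.

Lemma sum_probe a m n z :
  \sum_(1 <= j < n.+1) probe a m (rotation a j z) =
  (nc ((set_val a ^+ n * set_val z) ^+ m - 1) - nc (set_val z ^+ m - 1)) /
  nc (set_val a ^+ m - 1).
Proof.
rewrite /probe -mulr_suml; congr (_ / _); rewrite big_add1/=.
rewrite (@telescope_sumr_eq _ 0 n
  (fun j => nc ((set_val a ^+ j * set_val z) ^+ m - 1)))//.
  by rewrite expr0 mul1r.
move=> k _; congr (_ - _).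
have -> : set_val (rotation a k.+1 z) = set_val a * (set_val a ^+ k * set_val z).
  by rewrite mulrA -exprS.
rewrite exprMn -{2}[set_val a ^+ m]mulr1 -mulrBr Normc.normcM normcX.
by rewrite normc_circle expr1n mul1r.
Qed.

Lemma cvg_sumr (I : Type) (r : seq I) (s : I -> R^nat) (l : I -> R) :
  (forall i, s i @ \oo --> l i) ->
  \sum_(i <- r) s i N @[N --> \oo] --> \sum_(i <- r) l i.
Proof.
by move=> sl; apply: cvg_big => [|i _]; [exact: add_continuous|exact: sl].
Qed.

(** The orbit sum from z1 = 1 starts at the minimum of |z ^ m - 1|, and the one
    from z2 = a ^ -n ends there, so both boundary terms contribute
    nonnegatively to the difference. *)
Lemma probe_gap a m n z1 z2 :
  set_val z1 = 1 -> set_val a ^+ n * set_val z2 = 1 ->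
  nc (set_val a ^+ m ^+ n - 1) / nc (set_val a ^+ m - 1) <=
  \sum_(1 <= j < n.+1)
    (probe a m (rotation a j z1) - probe a m (rotation a j z2)).
Proof.
move=> z11 anz2; rewrite sumrB !sum_probe z11 mulr1 anz2 !expr1n subrr Normc.normc0.
rewrite subr0 sub0r mulNr opprK exprAC lerDl.
by rewrite divr_ge0 ?normc_ge0.
Qed.

(** An oscillation is insensitive to the constant c, so a lower bound on the
    mean of F - c is available without computing c. *)
Lemma supnorm_mean_real_ge a n (F : T -> R) (c : R) z1 z2 :
  (0 < n)%N -> continuous F ->
  \sum_(1 <= j < n.+1) (F (rotation a j z1) - F (rotation a j z2)) <=
  n%:R * (2 * supnorm (ergodic_mean a n (fun z => (F z - c)%:C%C))).
Proof.
move=> n0 cF; set f := fun z => _.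
have cf : continuous f.
  apply: continuous_real_complex; apply: continuous_sub => //.
  exact: cst_continuous.
have [M fM] := continuous_circle_bounded cf.
have fge z := supnorm_ge z (ergodic_mean_le a n0 fM).
have n0' : 0 < n%:R :> R by rewrite ltr0n.
set D := (X in X <= _).
have E : ergodic_mean a n f z1 - ergodic_mean a n f z2 = (n%:R^-1 * D)%:C%C.
  rewrite rmorphM fmorphV rmorph_nat rmorph_sum /ergodic_mean -mulrBr -sumrB.
  congr (_ * _); apply: eq_bigr => j _; rewrite /f -rmorphB.
  by congr (_%:C)%C; rewrite opprB addrA subrK.
rewrite -ler_pdivrMl//.
apply: le_trans (ler_norm _) _; rewrite -normc_real -E.
apply: le_trans (normc_triangle _ _) _; rewrite normc_oppr mulr2n mulrDl mul1r.
exact: lerD.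
Qed.

(** The function is the series of the probes of exponents m i with weights
    2 ^ -(i + 1), minus its integral; m i is chosen so that the i-th probe
    alone keeps the first 8 * 4 ^ i means above 2 ^ -i / 8. *)
Lemma divergent_mean_exists a (n : nat -> nat) :
  (forall m, (0 < m)%N -> ~~ m.-unity_root (set_val a)) ->
  (forall k, (0 < n k)%N) -> {homo n : i j / (i < j)%N} ->
  exists f : T -> R[i], [/\ continuous f, circle_integral f = 0 &
    forall A : R, exists K,
      A < \sum_(0 <= k < K) supnorm (ergodic_mean a (n k) f)].
Proof.
move=> a_root n_gt0 n_incr.
pose K i := (8 * 4 ^ i)%N.
have a1 : nc (set_val a) = 1 := normc_circle a.
have /choice[m m_small] i : exists m, (0 < m)%N /\
    (n (K i))%:R * nc (set_val a ^+ m - 1) <= 2^-1.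
  have n0 : 0 < (n (K i))%:R :> R by rewrite ltr0n.
  have e0 : 0 < (2 * (n (K i))%:R)^-1 :> R by rewrite invr_gt0 mulr_gt0.
  have [m m0 /ltW am] := small_power a1 e0.
  by exists m; split => //; rewrite mulrC -ler_pdivlMr// -invfM.
pose u i z := 2^-1 ^+ i.+1 * probe a (m i) z.
have [F cF uF] : exists2 F : T -> R, continuous F &
    forall z, series (u ^~ z) @ \oo --> F z.
  apply: continuous_series => [i|i z].
    exact/continuous_scale/continuous_probe.
  rewrite normrM ger0_norm ?exprn_ge0 ?invr_ge0//.
  by rewrite ler_piMr ?exprn_ge0 ?invr_ge0// normr_probe_le1.
have [c c_mean] := circle_integral_sub_mean cF.
exists (fun z => (F z - c)%:C%C); split => //.
  apply: continuous_real_complex; apply: continuous_sub => //.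
  exact: cst_continuous.
(* Only the i-th probe is estimated from below; the gaps of all others are
   nonnegative. *)
have mean_ge i k : (k < K i)%N ->
    2^-1 ^+ i / 8 <= supnorm (ergodic_mean a (n k) (fun z => (F z - c)%:C%C)).
  move=> kK.
  have [z1 z11] : exists z : T, set_val z = 1.
    by apply: circle_exists; exact: Normc.normc1.
  have [z2 z2E] : exists z : T, set_val z = (set_val a ^+ n k)^-1.
    by apply: circle_exists; rewrite Normc.normcV normcX a1 expr1n invr1.
  have anz2 : set_val a ^+ n k * set_val z2 = 1.
    by rewrite z2E divff// expf_neq0// circle_neq0.
  have n0 : 0 < (n k)%:R :> R by rewrite ltr0n.
  pose gap G := \sum_(1 <= j < (n k).+1) (G (rotation a j z1) - G (rotation a j z2)) : R.
  have gap_u l : gap (u l) = 2^-1 ^+ l.+1 * gap (probe a (m l)).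
    by rewrite /gap mulr_sumr; apply: eq_bigr => j _; rewrite /u mulrBr.
  have gap_u_ge0 l : 0 <= gap (u l).
    rewrite gap_u mulr_ge0 ?exprn_ge0 ?invr_ge0//.
    by apply: le_trans (probe_gap _ z11 anz2); rewrite divr_ge0 ?normc_ge0.
  have gap_ui : 2^-1 ^+ i.+1 * ((n k)%:R / 2) <= gap (u i).
    rewrite gap_u ler_wpM2l ?exprn_ge0 ?invr_ge0//.
    apply: le_trans (probe_gap _ z11 anz2).
    have [mi0 mi] := m_small i.
    rewrite ler_pdivlMr; last first.
      rewrite lt_neqAle normc_ge0 andbT eq_sym; apply/eqP.
      move=> /Normc.eq0_normc/eqP; rewrite subr_eq0 => am1.
      by move: (a_root _ mi0); rewrite unity_rootE am1.
    apply: normc_expB1_ge; first by rewrite normcX a1 expr1n.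
    apply: le_trans mi; rewrite ler_wpM2r ?normc_ge0// ler_nat ltnW//.
    exact: n_incr.
  have gap_F : 2^-1 ^+ i.+1 * ((n k)%:R / 2) <= gap F.
    have cvg_gap : \sum_(1 <= j < (n k).+1) (series (u ^~ (rotation a j z1)) N -
        series (u ^~ (rotation a j z2)) N) @[N --> \oo] --> gap F.
      by apply: cvg_sumr => j; apply: cvgB; exact: uF.
    move/cvgr_to_ge : cvg_gap; apply; exists i.+1 => // N /= iN.
    apply: (le_trans gap_ui).
    under eq_bigr do rewrite /series/= -sumrB.
    rewrite exchange_big/= big_mkord (bigD1 (Ordinal iN))//= lerDl.
    by apply: sumr_ge0 => l _; exact: gap_u_ge0.
  have := supnorm_mean_real_ge a c z1 z2 (n_gt0 k) cF.
  move/(le_trans gap_F); rewrite mulrCA ler_pM2l// exprS.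
  by set x := 2^-1 ^+ i; set s := supnorm _; lra.
move=> A.
have [i Ai] : exists i, A < 2 ^+ i.
  exists (Num.truncn `|A|).+1; apply: le_lt_trans (ler_norm _) _.
  apply: lt_le_trans (truncnS_gt _) _.
  by rewrite -natrX ler_nat ltnW// ltn_expl.
exists (K i); apply: lt_le_trans Ai _.
apply: (@le_trans _ _ (\sum_(0 <= k < K i) 2^-1 ^+ i / 8)); last first.
  rewrite big_nat [leRHS]big_nat; apply: ler_sum => k /andP[_].
  exact: mean_ge.
rewrite sumr_const_nat subn0 /K -[leRHS]mulr_natr natrM natrX.
have -> : 4%:R ^+ i = 2 ^+ i * 2 ^+ i :> R by rewrite -exprMn -natrM.
rewrite exprVn.
have : 2 ^+ i != 0 :> R by rewrite expf_neq0.
by move=> h; rewrite le_eqVlt; apply/orP; left; apply/eqP; field.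
Qed.

End witness.

(** * Density and the main theorem *)

Section divergence.
Context {R : realType}.
Local Notation nc := (@Normc.normc R).
Local Notation T := (circle R).
Implicit Types (f g : T -> R[i]) (a : T) (n : nat -> nat).

Definition mean_sum a n f (K : nat) : R :=
  \sum_(0 <= k < K) supnorm (ergodic_mean a (n k) f).

(** If the partial sums for f are bounded by N, then those for f + t g grow at
    least like t times those for g, minus N. *)
Lemma divergent_mean_dense a n f (e : R) :
  (forall m, (0 < m)%N -> ~~ m.-unity_root (set_val a)) ->
  (forall k, (0 < n k)%N) -> {homo n : i j / (i < j)%N} ->
  continuous f -> circle_integral f = 0 -> 0 < e ->
  exists h : T -> R[i], [/\ continuous h, circle_integral h = 0,
    forall z, nc (f z - h z) < e &
    forall N : nat, exists K, N%:R < mean_sum a n h K].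
Proof.
move=> a_root n_gt0 n_incr cf f0 e0.
have [fdiv|] := pselect (forall N : nat, exists K, N%:R < mean_sum a n f K).
  by exists f; split => // z; rewrite subrr Normc.normc0.
move=> /existsNP[N /forallNP fN].
have [g [cg g0 gdiv]] := divergent_mean_exists a_root n_gt0 n_incr.
have [M gM] := continuous_circle_bounded cg.
have M0 : 0 <= M by apply: le_trans (gM (expi 0)); exact: normc_ge0.
have M1 : 0 < M + 1 by rewrite ltr_wpDl.
pose t := e / (M + 1).
have t0 : 0 < t by rewrite divr_gt0.
exists (fun z => f z + t%:C%C * g z); split.
- exact: (continuous_lincomb (c := t%:C%C) cf cg).
- by rewrite circle_integralD// f0 g0 mulr0 addr0.
- move=> z; rewrite opprD addrA subrr sub0r normc_oppr.
  rewrite Normc.normcM normc_real gtr0_norm//.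
  apply: le_lt_trans (ler_wpM2l (ltW t0) (gM z)) _.
  by rewrite /t mulrAC ltr_pdivrMr// ltr_pM2l// ltrDl.
move=> m; have [K] := gdiv ((N%:R + m%:R) / t); rewrite -/(mean_sum a n g K).
rewrite ltr_pdivrMr// mulrC => gK; exists K.
have fK : mean_sum a n f K <= N%:R by rewrite leNgt; apply/negP/fN.
have : t * mean_sum a n g K <=
    mean_sum a n (fun z => f z + t%:C%C * g z) K + mean_sum a n f K.
  rewrite /mean_sum mulr_sumr -big_split/=; apply: ler_sum => k _.
  exact: supnorm_mean_perturb.
lra.
Qed.

Lemma mean_sum_close a n f g (d : R) K : (forall k, (0 < n k)%N) ->
  continuous f -> continuous g -> (forall z, nc (f z - g z) < d) ->
  mean_sum a n f K <= mean_sum a n g K + K%:R * d.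
Proof.
move=> n_gt0 cf cg fg; rewrite -[K in K%:R * d](subn0 K) mulr_natl.
rewrite -sumr_const_nat -big_split/=; apply: ler_sum => k _.
exact: supnorm_mean_close.
Qed.

Lemma mean_series_pinfty a n f : (forall k, (0 < n k)%N) -> continuous f ->
  (forall N : nat, exists K, N%:R < mean_sum a n f K) ->
  (\sum_(0 <= k <oo) (supnorm (ergodic_mean a (n k) f))%:E = +oo)%E.
Proof.
move=> n_gt0 cf fdiv; apply/eqyP => A _.
have [K AK] := fdiv (Num.truncn A).+1.
apply: (@le_trans _ _ (\sum_(0 <= k < K) (supnorm (ergodic_mean a (n k) f))%:E)%E).
  by rewrite sumEFin lee_fin; apply/ltW/(lt_trans _ AK)/truncnS_gt.
apply: nneseries_lim_ge => k _ _; rewrite lee_fin.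
have [M fM] := continuous_circle_bounded cf.
exact: supnorm_ge0 (ergodic_mean_le _ (n_gt0 k) fM).
Qed.

End divergence.

Theorem proposition7p1 (R : realType) (alpha : circle R)
  (halpha : forall m : nat, (0 < m)%N -> ~~ m.-unity_root (set_val alpha))
  (n : nat -> nat) (n_gt0 : forall k, (0 < n k)%N)
  (n_incr : {homo n : i j / (i < j)%N}) :
  exists B : set (set_type (@mean_zero R)),
    [/\ dense B, Gdelta B &
      forall f, B f ->
        (\sum_(0 <= k <oo) (supnorm (ergodic_mean alpha (n k) (set_val f)))%:E
          = +oo)%E].
Proof.
have cts (f : set_type (@mean_zero R)) : continuous (set_val f : circle R -> R[i]).
  exact: cts_fun.
pose V (N : nat) := [set g : continuousType (circle R) R[i] |
  exists K, N%:R < mean_sum alpha n g K].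
pose U N : set (set_type (@mean_zero R)) := set_val @^-1` V N.
exists (\bigcap_N U N); split.
- move=> O [f Of] [W oW WO]; rewrite -WO in Of *.
  have /nbhs_continuousTypeP[e e0 eW] : nbhs (set_val f) W by exact: open_nbhs_nbhs.
  have [h [ch h0 fh hdiv]] :=
    divergent_mean_dense halpha n_gt0 n_incr (cts f) (set_mem (valP f)) e0.
  have h0' : (mkcts ch : continuousType (circle R) R[i]) \in @mean_zero R.
    by apply/mem_set; exact: h0.
  exists (SigSub h0'); split; first by apply: eW; exact: fh.
  by move=> N _; exact: hdiv.
- exists U => // N; exists (V N) => //; rewrite openE => f [K fK].
  have d0 : 0 < (mean_sum alpha n f K - N%:R) / K.+1%:R.
    by rewrite divr_gt0// subr_gt0.
  apply/nbhs_continuousTypeP; eexists; first exact: d0.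
  move=> g fg; exists K.
  have close := mean_sum_close alpha K n_gt0 (@cts_fun _ _ f) (@cts_fun _ _ g) fg.
  rewrite -(ltrD2r (K%:R * ((mean_sum alpha n f K - N%:R) / K.+1%:R))).
  apply: lt_le_trans close; rewrite -ltrBrDl mulrCA.
  by rewrite gtr_pMr ?subr_gt0// ltr_pdivrMr// mul1r ltr_nat.
- by move=> f Bf; apply: mean_series_pinfty (cts f) _ => // N; exact: Bf.
Qed.
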